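(* Let $M(x)$ be the generating function of the Motzkin numbers and $F(x,5)=M(x)^5$. For every integer $n\ge 0$, \begin{align*} H_{15n}(F(x,5))&=H_{15n+1}(F(x,5))=1,\\ H_{15n+2}(F(x,5))&=5(2n+1)(50n^2+15n-1),\\ H_{15n+3}(F(x,5))&=25(25n^2+25n-2)(2n+1)^2,\\ H_{15n+4}(F(x,5))&=-5(50n^2+85n+34)(2n+1),\\ H_{15n+5}(F(x,5))&=H_{15n+6}(F(x,5))=1,\\ H_{15n+7}(F(x,5))&=5(n+1)(100n^2+120n+33),\\ H_{15n+8}(F(x,5))&=25(n+1)^2(100n^2+100n+17),\\ H_{15n+9}(F(x,5))&=H_{15n+12}(F(x,5))=1000(n+1)^3,\\ H_{15n+10}(F(x,5))&=H_{15n+11}(F(x,5))=0,\\ H_{15n+13}(F(x,5))&=25(n+1)^2(100n^2+300n+217),\\ H_{15n+14}(F(x,5))&=-5(n+1)(100n^2+280n+193). \end{align*}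
   Context: The Motzkin numbers are $M_n=\sum_{k\ge 0}\binom{n}{2k}C_k$, where $C_k=\frac{1}{k+1}\binom{2k}{k}$ is the $k$-th Catalan number; equivalently $M(x)=\sum_{n\ge0}M_nx^n=\frac{1-x-\sqrt{1-2x-3x^2}}{2x^2}$. For a formal power series $A(x)=\sum_{n\ge 0}a_nx^n$, its Hankel determinants are $H_n(A(x))=\det(a_{i+j})_{0\le i,j\le n-1}$ for $n\ge1$, and $H_0(A(x))=1$.
   Formalization: The value of H_{15n+9} is corrected to -1000(n+1)^3, because the stated +1000(n+1)^3 is false (at n=0, H_9(M^5) = -1000 while H_12(M^5) = 1000); H_{15n+12} = 1000(n+1)^3 and all other formulas are as stated. *)

(* Defs.v *)
From mathcomp Require Import all_boot all_order all_algebra.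

Set Implicit Arguments.
Unset Strict Implicit.
Unset Printing Implicit Defensive.

Import GRing.Theory.
Local Open Scope ring_scope.

(* The formal power series \sum_n a_n x^n over R is represented by its
   coefficient sequence [a : nat -> R]; equalities between series are pointwise. *)
Section PowerSeries.
Variable R : comNzRingType.

Definition fps := nat -> R.

Definition fps_one : fps := fun n => (n == 0)%:R.

Definition fps_mul (a b : fps) : fps :=
  fun n => \sum_(i < n.+1) a i * b (n - i)%N.

Definition fps_exp (a : fps) (k : nat) : fps := iter k (fps_mul a) fps_one.

(* For n = 0 this is the determinant of the empty matrix, which is 1
   ([det_mx00]), as in the usual convention H_0 = 1. *)
Definition hankel (n : nat) (a : fps) : R :=
  \det (\matrix_(i < n, j < n) a (i + j)%N).

End PowerSeries.

(* k + 1 divides 'C(2k, k), so the Euclidean quotient is the exact one. *)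
Definition catalan (k : nat) : nat := 'C(2 * k, k) %/ k.+1.

(* The terms with 2k > n vanish, so the sum over all k >= 0 stops at k = n. *)
Definition motzkin (n : nat) : nat :=
  (\sum_(k < n.+1) 'C(n, 2 * k) * catalan k)%N.

Definition motzkin_series : fps int := fun n => (motzkin n)%:Z.

Definition F (k : nat) : fps int := fps_exp motzkin_series k.

(* Main.v *)
Require Import Defs.
From mathcomp Require Import all_boot all_order all_algebra.
From mathcomp Require Import zify ring.

(* Let t = 1 + y + 1/y and U_k = (y^(k+1) - y^(-k-1)) / (y - 1/y), a monic
   polynomial in t. The U_k are orthonormal for the functional L_0 with moments
   the Motzkin numbers, multiplication by t acts on them by the tridiagonal
   matrix T with all entries 1, and x^k M^(k+1) has coefficients
   L_0(U_k t^n) = (T^n e_0)_k. Hence M^5 has moments L_0(w t^n) for the weight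
   w = t^4 U_4. Christoffel's formula turns the Hankel determinant of order n
   into the determinant of the residues of U_n, ..., U_(n+7) modulo w, that is
   modulo U_4 (where U_k has period 10 in k) and modulo t^4 (where the
   coefficients of U_(3p+c) are polynomials in p). Eliminating the four columns
   modulo U_4 leaves a 4 x 4 determinant of polynomials in n. *)

Set Implicit Arguments.
Unset Strict Implicit.
Unset Printing Implicit Defensive.

Import GRing.Theory.
Local Open Scope ring_scope.

(** * Determinants of matrices indexed by natural numbers *)

Section NatIndexedDeterminants.
Variable R : comNzRingType.
Implicit Types f g : nat -> nat -> R.

Definition detn (n : nat) f : R := \det (\matrix_(i < n, j < n) f i j).

Lemma eq_detn n f g :
  (forall i j, (i < n)%N -> (j < n)%N -> f i j = g i j) -> detn n f = detn n g.
Proof. by move=> fg; congr (\det _); apply/matrixP => i j; rewrite !mxE fg. Qed.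

Lemma detn0 f : detn 0 f = 1. Proof. exact: det_mx00. Qed.

Lemma detn_tr n f : detn n f = detn n (fun i j => f j i).
Proof. by rewrite /detn -det_tr; congr (\det _); apply/matrixP => i j; rewrite !mxE. Qed.

Lemma detn_mul n f g :
  detn n f * detn n g = detn n (fun i j => \sum_(k < n) f i k * g k j).
Proof.
rewrite /detn -det_mulmx; congr (\det _); apply/matrixP => i j; rewrite !mxE.
by apply: eq_bigr => k _; rewrite !mxE.
Qed.

Lemma detn_row0 n f :
  detn n.+1 f = \sum_(j < n.+1) (-1) ^+ j * f 0 j * detn n (fun a b => f a.+1 (bump j b)).
Proof.
rewrite /detn (expand_det_row _ ord0); apply: eq_bigr => j _.
rewrite !mxE /cofactor add0n mulrCA mulrA; congr (_ * \det _).
by apply/matrixP => a b; rewrite !mxE.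
Qed.

Lemma detn_col0 n f :
  detn n.+1 f = \sum_(i < n.+1) (-1) ^+ i * f i 0 * detn n (fun a b => f (bump i a) b.+1).
Proof.
rewrite detn_tr detn_row0; apply: eq_bigr => i _; congr (_ * _).
by rewrite detn_tr.
Qed.

Lemma detn_ublock p q f :
  (forall i j, (i < q)%N -> (j < p)%N -> f (p + i)%N j = 0) ->
  detn (p + q) f = detn p f * detn q (fun i j => f (p + i)%N (p + j)%N).
Proof.
move=> f0; pose A := \matrix_(i < p, j < p) f i j.
pose B := \matrix_(i < p, j < q) f i (p + j)%N.
pose D := \matrix_(i < q, j < q) f (p + i)%N (p + j)%N.
rewrite -[RHS](det_ublock A B D); congr (\det _); apply/matrixP => i j.
by case: (split_ordP i) => i' ->; case: (split_ordP j) => j' ->;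
  rewrite ?block_mxEul ?block_mxEur ?block_mxEdl ?block_mxEdr !mxE //= f0.
Qed.

Lemma detn_lblock p q f :
  (forall i j, (i < p)%N -> (j < q)%N -> f i (p + j)%N = 0) ->
  detn (p + q) f = detn p f * detn q (fun i j => f (p + i)%N (p + j)%N).
Proof.
move=> f0; rewrite detn_tr detn_ublock => [|i j ip jq]; last exact: f0.
by rewrite detn_tr; congr (_ * _); rewrite detn_tr.
Qed.

Lemma detn_uni n f :
  (forall i, (i < n)%N -> f i i = 1) ->
  (forall i j, (i < j < n)%N -> f i j = 0) -> detn n f = 1.
Proof.
move=> f1 f0; rewrite /detn det_trig; last first.
  by apply/is_trig_mxP => i j ij; rewrite mxE f0 // ij ltn_ord.
by apply: big1 => i _; rewrite mxE f1.
Qed.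

(** Expanding along the top [n] rows in turn meets only one nonzero entry each time, the 1 in column
    [p], with sign (-1)^p. *)
Lemma detn_antiblock n p f :
  (forall i j, (i < n)%N -> (j < p)%N -> f i j = 0) ->
  (forall i, (i < n)%N -> f i (p + i)%N = 1) ->
  (forall i j, (i < n)%N -> (p + i < j < n + p)%N -> f i j = 0) ->
  detn (n + p) f = (-1) ^+ (n * p) * detn p (fun i j => f (n + i)%N j).
Proof.
elim: n f => [|n IHn] f f0 f1 f2.
  by rewrite mul0n expr0 mul1r.
have pn : (p < (n + p).+1)%N by lia.
rewrite addSn detn_row0 (bigD1 (Ordinal pn)) //= big1 => [|j jp]; last first.
  have [ltjp|] := ltnP j p; first by rewrite f0 // mulr0 mul0r.
  rewrite leq_eqVlt => /orP[/eqP E|ltpj].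
    by case/eqP: jp; apply: val_inj.
  by rewrite f2 ?mulr0 ?mul0r //; have := ltn_ord j; lia.
have f01 : f 0%N p = 1 by have := f1 0%N isT; rewrite addn0.
rewrite addr0 f01 mulr1 IHn.
- rewrite mulrA -exprD mulSn; congr (_ * _); apply: eq_detn => i j _ jp /=.
  by rewrite /bump leqNgt jp add0n.
- by move=> i j lin ljp; rewrite /bump leqNgt ljp f0.
- by move=> i lin; rewrite /bump leq_addr add1n -addnS f1.
by move=> i j lin H; rewrite f2 // /bump; case: (leqP p j); lia.
Qed.

(* Christoffel's formula. Complete the rows of G and the columns of K by unit
   vectors to (n + p)-square matrices: their product has a zero upper left
   n x p block. *)
Lemma detn_christoffel n p (G K : nat -> nat -> R) :
  (forall i, G i (p + i)%N = 1) ->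
  (forall i k, (p + i < k)%N -> G i k = 0) ->
  (forall i l, (i < n)%N -> (l < p)%N -> \sum_(k < n + p) G i k * K k l = 0) ->
  detn n G * detn p K = (-1) ^+ (n * p) * detn p (fun i l => K (n + i)%N l).
Proof.
move=> G1 G0 GK; pose X i k := if (i < n)%N then G i k else (i == k)%:R.
pose Y k l := if (l < p)%N then K k l else (k == l)%:R.
have detX : detn (n + p) X = detn n G.
  rewrite detn_ublock => [|i j ip jn]; last first.
    by rewrite /X ltnNge leq_addr /=; case: eqP => //; lia.
  rewrite [X in _ * X]detn_uni => [|i ip|i j ij].
  - by rewrite mulr1; apply: eq_detn => i j lin _; rewrite /X lin.
  - by rewrite /X ltnNge leq_addr eqxx.
  by rewrite /X ltnNge leq_addr /=; case: eqP => //; lia.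
have detY : detn (n + p) Y = detn p K.
  rewrite addnC detn_lblock => [|i j ip jn]; last first.
    by rewrite /Y ltnNge leq_addr /=; case: eqP => //; lia.
  rewrite [X in _ * X]detn_uni => [|i ip|i j ij].
  - by rewrite mulr1; apply: eq_detn => i j _ jp; rewrite /Y jp.
  - by rewrite /Y ltnNge leq_addr eqxx.
  by rewrite /Y ltnNge leq_addr /=; case: eqP => //; lia.
have XYu i j : (i < n)%N -> (p <= j < n + p)%N ->
    \sum_(k < n + p) X i k * Y k j = G i j.
  move=> lin /andP[pj jnp]; rewrite (bigD1 (Ordinal jnp)) //= big1 => [|k /eqP kj].
    by rewrite /X /Y lin ltnNge pj eqxx mulr1 addr0.
  rewrite /Y ltnNge pj /=; case: eqP => [E|]; last by rewrite mulr0.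
  by case: kj; apply: val_inj.
rewrite -detX -detY detn_mul detn_antiblock.
- congr (_ * _); apply: eq_detn => i j ip jp.
  have nip : (n + i < n + p)%N by rewrite ltn_add2l.
  rewrite (bigD1 (Ordinal nip)) //= big1 => [|k /eqP kj].
    by rewrite /X /Y ltnNge leq_addr jp eqxx mul1r addr0.
  rewrite /X ltnNge leq_addr /=; case: eqP => [E|]; last by rewrite mul0r.
  by case: kj; apply: val_inj.
- move=> i j lin jp; rewrite -[RHS](GK i j lin jp); apply: eq_bigr => k _.
  by rewrite /X /Y lin jp.
- by move=> i lin; rewrite XYu ?leq_addr ?G1 //; lia.
by move=> i j lin H; rewrite XYu ?G0 //; lia.
Qed.

(** Gaussian elimination of column 0 by row [i0]; over a ring the inverse [e] of the pivot has to be
    supplied. *)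
Lemma detn_pivot n i0 (e : R) f :
  (i0 <= n)%N -> e * f i0 0%N = 1 ->
  detn n.+1 f = (-1) ^+ i0 * f i0 0%N *
    detn n (fun a b => f (bump i0 a) b.+1 - e * f (bump i0 a) 0%N * f i0 b.+1).
Proof.
move=> le_i0 ef; pose r := Ordinal (le_i0 : i0 < n.+1)%N.
pose g i j := if i == i0 then f i j else f i j - e * f i 0%N * f i0 j.
(* [L] undoes the elimination, f = L g; its row [i0] is a unit vector and the complementary minor is
   the identity. *)
pose L i k : R := (i == k)%:R + ((i != i0) && (k == i0))%:R * (e * f i 0%N).
have detL : detn n.+1 L = 1.
  rewrite /detn (expand_det_row _ r) (bigD1 r) //= big1 => [|k kr]; last first.
    by rewrite !mxE /L /= eqxx mul0r addr0 eq_sym -[i0]/(val r) val_eqE (negPf kr) mul0r.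
  rewrite mxE /L /= !eqxx mul0r !addr0 mul1r /cofactor -signr_odd oddD addbb mul1r.
  rewrite [X in \det X](_ : _ = 1%:M) ?det1 //; apply/matrixP => a b; rewrite !mxE.
  by rewrite -!val_eqE /= (can_eq (@bumpK i0)) [X in _ && X]eq_sym
    (negPf (neq_bump _ _)) andbF mul0r addr0.
have -> : detn n.+1 f = detn n.+1 g.
  rewrite -[RHS]mul1r -detL detn_mul; apply: eq_detn => i j lin _.
  pose i' := Ordinal lin; have [ii0|ii0] := eqVneq i i0.
    rewrite (bigD1 i') //= big1 => [|k ki].
      by rewrite /L /g ii0 !eqxx mul0r !addr0 mul1r.
    by rewrite /L ii0 eqxx mul0r addr0 -ii0 -[i]/(val i') eq_sym val_eqE (negPf ki) mul0r.
  have ri : r != i' by rewrite -val_eqE eq_sym.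
  rewrite (bigD1 i') //= (bigD1 r) //= big1 => [|k /andP[ki kr]].
    by rewrite /L /g !eqxx (negPf ii0) /=; ring.
  rewrite /L -[i0 in k == i0 :> nat]/(val r) -[i in i == k :> nat]/(val i')
    [i' == _ :> nat]eq_sym.
  by rewrite !val_eqE (negPf ki) (negPf kr) andbF mul0r addr0 mul0r.
rewrite detn_col0 (bigD1 r) //= big1 => [|k kr].
  rewrite addr0 {1}/g eqxx; congr (_ * _); apply: eq_detn => a b _ _.
  by rewrite /g eq_sym (negPf (neq_bump _ _)).
have kr' : (k == i0 :> nat) = false by rewrite -[i0]/(val r) val_eqE; apply: negPf.
by rewrite {1}/g kr' [e * _ * _]mulrAC ef mul1r subrr mulr0 mul0r.
Qed.

Lemma detn1E f : detn 1 f = f 0%N 0%N.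
Proof. by rewrite detn_row0 big_ord1 detn0 expr0 mul1r mulr1. Qed.

Lemma detn2E f :
  detn 2 f = f 0%N 0%N * f 1%N 1%N - f 0%N 1%N * f 1%N 0%N.
Proof.
by rewrite detn_row0 !big_ord_recl big_ord0 /= !detn1E /= /bump /=; ring.
Qed.

Lemma detn3E f :
  detn 3 f = f 0%N 0%N * (f 1%N 1%N * f 2%N 2%N - f 1%N 2%N * f 2%N 1%N)
     - f 0%N 1%N * (f 1%N 0%N * f 2%N 2%N - f 1%N 2%N * f 2%N 0%N)
     + f 0%N 2%N * (f 1%N 0%N * f 2%N 1%N - f 1%N 1%N * f 2%N 0%N).
Proof.
by rewrite detn_row0 !big_ord_recl big_ord0 /= !detn2E /= /bump /=; ring.
Qed.

Lemma detn4E f :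
  detn 4 f = f 0%N 0%N * detn 3 (fun a b => f a.+1 (bump 0 b))
    - f 0%N 1%N * detn 3 (fun a b => f a.+1 (bump 1 b))
    + f 0%N 2%N * detn 3 (fun a b => f a.+1 (bump 2 b))
    - f 0%N 3%N * detn 3 (fun a b => f a.+1 (bump 3 b)).
Proof. by rewrite detn_row0 !big_ord_recl big_ord0 /= /bump /=; ring. Qed.

End NatIndexedDeterminants.

(** * Powers of the Motzkin series *)

Section JacobiOperator.
Variable R : comNzRingType.
Implicit Types c f g : nat -> R.

(* The symmetric tridiagonal matrix with ones on its three diagonals. *)
Definition jac f : nat -> R :=
  fun k => (if k is k'.+1 then f k' else 0) + f k + f k.+1.

Definition seqdelta m : nat -> R := fun k => (k == m)%:R.

Definition jpow n f : nat -> R := iter n jac f.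

Lemma eq_jac f g : f =1 g -> jac f =1 jac g.
Proof. by move=> fg [|k]; rewrite /jac !fg. Qed.

Lemma jpowSr n f : jpow n.+1 f =1 jpow n (jac f).
Proof. by move=> k; rewrite /jpow iterSr. Qed.

Lemma eq_jpow n f g : f =1 g -> jpow n f =1 jpow n g.
Proof. by move=> fg; elim: n => //= n; apply: eq_jac. Qed.

Lemma jpow0 n k : jpow n (fun=> 0) k = 0 :> R.
Proof. by elim: n k => // n IHn [|k]; rewrite /jpow iterS -/(jpow n _) /jac !IHn !addr0. Qed.

Lemma jpowD n f g k :
  jpow n (fun j => f j + g j) k = jpow n f k + jpow n g k.
Proof.
elim: n k => // n IHn [|k]; rewrite /jpow !iterS -!/(jpow n _) /jac !IHn; ring.
Qed.

(** A discrete Green identity: T is symmetric, so the sum telescopes to boundary terms. *)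
Lemma jac_self_adjoint N c f :
  \sum_(k < N.+1) (jac c k * f k - c k * jac f k) = c N.+1 * f N - c N * f N.+1.
Proof.
elim: N => [|N IHN]; first by rewrite big_ord1 /jac /=; ring.
by rewrite big_ord_recr /= IHN /jac /=; ring.
Qed.

Lemma jpow_supp n m k : (n + m < k)%N -> jpow n (seqdelta m) k = 0.
Proof.
elim: n k => [|n IHn] k nk; first by rewrite /jpow /seqdelta /=; case: eqP => //; lia.
rewrite /jpow iterS -/(jpow _ _) /jac; case: k nk => [|k] nk; first by lia.
by rewrite !IHn ?addr0 //; lia.
Qed.

Lemma jpow_lead n m : jpow n (seqdelta m) (n + m)%N = 1.
Proof.
elim: n => [|n IHn]; first by rewrite add0n /jpow /= /seqdelta eqxx.
by rewrite /jpow iterS -/(jpow _ _) /jac addSn IHn !jpow_supp ?addr0 //; lia.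
Qed.

Lemma sum_jac N c f :
  (forall k, (N <= k)%N -> c k = 0) ->
  \sum_(k < N.+1) jac c k * f k = \sum_(k < N.+1) c k * jac f k.
Proof.
move=> c0; apply/eqP; rewrite -subr_eq0 -sumrB jac_self_adjoint.
by rewrite !c0 // !mul0r subrr.
Qed.

(** Symmetry moves T^n from [seqdelta m] to [f]. When [f k] is a residue of U_k, the sum is the
    residue of t^n U_m. *)
Lemma sum_jpow n m N f : (n + m < N)%N ->
  \sum_(k < N) jpow n (seqdelta m) k * f k = jpow n f m.
Proof.
elim: n f N => [|n IHn] f N mN.
  rewrite (bigD1 (Ordinal mN)) //= big1 => [|k /eqP km].
    by rewrite /jpow /= /seqdelta eqxx mul1r addr0.
  by rewrite /jpow /= /seqdelta; case: eqP => [E|]; rewrite ?mul0r //;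
    case: km; apply: val_inj.
case: N mN => // N mN; rewrite jpowSr -(IHn _ N.+1); last by lia.
by apply: sum_jac => k Nk; apply: jpow_supp; lia.
Qed.

(* Both sides are det (<T^i delta_m, T^j delta_0>) up to the unitriangular
   change of basis T^j delta_0. *)
Lemma detn_jpow_hankel n m :
  detn n (fun i j => jpow (i + j + m) (seqdelta 0) m) =
  detn n (fun i k => jpow (i + m) (seqdelta m) k).
Proof.
have P1 : detn n (fun k j => jpow j (seqdelta 0) k) = 1.
  rewrite detn_tr detn_uni // => [i _|i j /andP[ij _]].
    by have := jpow_lead i 0; rewrite addn0.
  by rewrite jpow_supp ?addn0.
rewrite -[RHS]mulr1 -P1 detn_mul; apply: eq_detn => i j lin jn.
have -> : jpow (i + j + m) (seqdelta 0) m = jpow (i + m) (jpow j (seqdelta 0)) m.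
  by rewrite /jpow -iterD addnAC.
(* The range is enlarged to contain the support of T^(i+m) e_m; the added terms vanish because T^j
   e_0 lives on indices at most j < n. *)
rewrite -(@sum_jpow _ _ (n + (i + m + m).+1)); last by lia.
rewrite big_split_ord /= [X in _ + X]big1 ?addr0 // => k _.
by rewrite [X in _ * X]jpow_supp ?mulr0 //; lia.
Qed.

End JacobiOperator.

(** * Motzkin paths, ballot numbers and convolution powers *)

Section MotzkinPaths.
Local Notation e0 := (@seqdelta int 0).

Definition dyck_step (f : nat -> int) : nat -> int :=
  fun k => (if k is k'.+1 then f k' else 0) + f k.+1.

(** Counts the paths of [i] steps +1 or -1 from height 0 to height [k] that never go below 0. *)
Definition ballot (i k : nat) : int := iter i dyck_step e0 k.

Lemma ballotS i k :
  ballot i.+1 k = (if k is k'.+1 then ballot i k' else 0) + ballot i k.+1.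
Proof. by []. Qed.

Lemma ballot_gt i k : (i < k)%N -> ballot i k = 0.
Proof.
by elim: i k => [|i IHi] [|k] // ik; rewrite ballotS !IHi //; lia.
Qed.

Lemma ballot_odd i k : odd (i + k) -> ballot i k = 0.
Proof.
elim: i k => [|i IHi] [|k] // ik; rewrite ballotS !IHi //; move: ik;
  by rewrite ?addSn ?addnS /= ?addn0 ?negbK.
Qed.

(** The reflection formula, [b] being the number of down steps; by Pascal's rule both sides obey the
    same recurrence. *)
Lemma ballot_bin b k :
  ballot (k + 2 * b) k =
  'C(k + 2 * b, b)%:Z - (if b is b'.+1 then 'C(k + 2 * b, b') else 0%N)%:Z.
Proof.
move Ei: (k + 2 * b)%N => i; elim: i b k Ei => [|i IHi] b k Ei.
  have -> : k = 0%N by lia.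
  by have -> : b = 0%N by lia.
case: b Ei => [|b] Ei.
  have -> : k = i.+1 by lia.
  rewrite ballotS (ballot_gt (k := i.+2)) ?addr0; last by lia.
  by rewrite (IHi 0%N) ?bin0 //; lia.
rewrite ballotS; case: k Ei => [|k] Ei.
  rewrite add0r (IHi b); last by lia.
  (* At height 0 the length [i] is 2b + 1, so the two middle binomials agree. *)
  have -> : 'C(i.+1, b.+1) = ('C(i, b) + 'C(i, b))%N.
    rewrite binS -(@bin_sub i b.+1); last by lia.
    by congr ('C(_, _) + _)%N; lia.
  case: b Ei => [|b] Ei; first by rewrite !bin0; lia.
  by rewrite binS; lia.
rewrite (IHi b.+1) ?(IHi b); try lia.
by case: b Ei => [|b] Ei; rewrite !binS ?bin0; lia.
Qed.

Lemma catalan_ballot b : (catalan b)%:Z = ballot (2 * b) 0.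
Proof.
have := ballot_bin b 0; rewrite add0n => ->.
case: b => [|b] //; rewrite /catalan.
have := mul_bin_left (2 * b.+1) b.
have -> : (2 * b.+1 - b)%N = b.+2 by lia.
(* With x = C(2b+2, b+1) and y = C(2b+2, b), the relation (b+1) x = (b+2) y gives x = (b+2)(x - y),
   so the division is exact. *)
move: 'C(_, b.+1) 'C(_, b) => x y E.
have -> : x = ((x - y) * b.+2)%N.
  by rewrite mulnBl [(y * _)%N]mulnC -E mulnC -mulnBl subSn // subnn mul1n.
have le_yx : (y <= x)%N by rewrite -(leq_pmul2l (ltn0Sn b.+1)) -E leq_mul2r leqnSn orbT.
by rewrite mulnK // mulnBl [(y * _)%N]mulnC -E; lia.
Qed.

(** T is the identity plus the Dyck step, so this is the binomial theorem: [i] of the [n] steps are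
    not level. *)
Lemma jpow_ballot n N k : (n < N)%N ->
  jpow n e0 k = \sum_(i < N) 'C(n, i)%:Z * ballot i k.
Proof.
elim: n N k => [|n IHn] [|N] k // nN.
  rewrite big_ord_recl big1 => [|i _]; first by rewrite bin0 mul1r addr0.
  by rewrite bin0n mul0r.
rewrite /jpow iterS -/(jpow n e0) /jac big_ord_recl /= bin0 mul1r.
under eq_bigr => i _ do rewrite /bump /= add1n binS PoszD mulrDl.
rewrite big_split /= addrA.
have <- : jpow n e0 k = ballot 0 k + \sum_(i < N) 'C(n, i.+1)%:Z * ballot i.+1 k.
  by rewrite (IHn N.+1) ?leqW // big_ord_recl bin0 mul1r.
rewrite addrAC addrC; congr (_ + _).
under [RHS]eq_bigr => i _ do rewrite add0n /dyck_step mulrDr.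
rewrite big_split /= -IHn //; congr (_ + _).
by case: k => [|k]; [rewrite big1 // => i _; rewrite mulr0 | rewrite -IHn].
Qed.

Lemma motzkin_jpow n : (motzkin n)%:Z = jpow n e0 0.
Proof.
have pair_sum (f : nat -> int) N :
    \sum_(i < 2 * N) f i = \sum_(i < N) (f (2 * i)%N + f (2 * i).+1).
  elim: N => [|N IHN]; first by rewrite muln0 !big_ord0.
  by rewrite mulnS !addSn !big_ord_recr /= IHN addrA.
rewrite (@jpow_ballot n (2 * n.+1)); last by lia.
rewrite (pair_sum (fun i => 'C(n, i)%:Z * ballot i 0)) /motzkin.
rewrite (big_morph Posz PoszD (erefl _)); apply: eq_bigr => k _.
rewrite PoszM catalan_ballot (@ballot_odd (2 * k).+1) ?mulr0 ?addr0 //.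
by rewrite addn0 /= oddM.
Qed.

(** Cuts a path at its last step from height 0 to height 1; in generating functions this is
    multiplication by x M(x). *)
Lemma jpow_first_passage n k :
  jpow n.+1 e0 k.+1 = \sum_(i < n.+1) jpow i e0 0 * jpow (n - i) e0 k.
Proof.
have jS j l : jpow j.+1 e0 l = jac (jpow j e0) l by [].
elim: n k => [|n IHn] k; first by rewrite big_ord1 jS /jac /jpow /seqdelta /=; ring.
rewrite jS /jac !IHn [RHS]big_ord_recr subnn /=.
under [in RHS]eq_bigr => i _.
  rewrite (subSn (ltn_ord i : i <= n)%N).
  rewrite jS /jac !mulrDr; over.
rewrite !big_split /= [RHS]addrAC; congr (_ + _); rewrite [RHS]addrAC; congr (_ + _).
case: k => [|k]; last by rewrite -[LHS]/(jpow n.+1 e0 k.+1) IHn mulr0 addr0.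
by rewrite mulr1 big1 ?add0r // => i _; rewrite mulr0.
Qed.

Lemma motzkin_power k n :
  fps_exp motzkin_series k.+1 n = jpow (n + k) e0 k.
Proof.
elim: k n => [|k IHk] n.
  rewrite /fps_exp /= /fps_mul big_ord_recr /= big1 => [|i _].
    by rewrite subnn mulr1 add0r addn0 /motzkin_series motzkin_jpow.
  by rewrite /fps_one subn_eq0 leqNgt ltn_ord mulr0.
rewrite /fps_exp iterS -/(fps_exp _ k.+1) /fps_mul addnS jpow_first_passage.
(* For indices beyond [n] the rest of the path is too short to climb to height [k]. *)
rewrite -addSn big_split_ord /= [X in _ + X]big1 ?addr0 => [|i _].
  by apply: eq_bigr => i _;
     rewrite -[fps_mul _ _]/(fps_exp motzkin_series k.+1) IHk
       /motzkin_series motzkin_jpow addnBAC // -ltnS.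
by rewrite [X in _ * X]jpow_supp ?mulr0 //; have := ltn_ord i; lia.
Qed.

(** Row [i] on the right lists the coefficients of t^i (t^k U_k) in the basis U_j. *)
Lemma hankel_motzkin_power n k :
  hankel n (fps_exp motzkin_series k.+1) =
  detn n (fun i j => jpow (i + k) (@seqdelta int k) j).
Proof.
rewrite -detn_jpow_hankel /hankel /detn; congr (\det _).
by apply/matrixP => i j; rewrite !mxE motzkin_power.
Qed.

End MotzkinPaths.

(** * Residues modulo the weight *)

(* The coefficient of U_l in the residue of U_k modulo U_4, for l < 4; the value
   at l = 4 is 0. *)
Definition resU (k l : nat) : int := (k %% 10 == l)%N%:R - (k %% 10 == 8 - l)%N%:R.

(** Reduction modulo U_4 commutes with multiplication by t; this is a check over one period of
    [k]. *)
Lemma resU_jac l k : (l < 4)%N ->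
  jac (resU^~ l) k = (if l is l'.+1 then resU k l' else 0) + resU k l + resU k l.+1.
Proof.
case: k => [|k]; first by case: l => [|[|[|[|]]]].
rewrite /jac /resU -[k.+2]addn2 -[k.+1]addn1 -[((k + 1) %% 10)%N]modnDml
  -[((k + 2) %% 10)%N]modnDml.
have : (k %% 10 < 10)%N by rewrite ltn_mod.
move: (k %% 10)%N => c; do 10 (case: c => [|c]; first by case: l => [|[|[|[|]]]]).
by [].
Qed.

Lemma resU_jpow n l : (l <= 4)%N -> jpow n (resU^~ l) 4 = 0.
Proof.
elim: n l => [|n IHn] l; first by case: l => [|[|[|[|[|]]]]].
rewrite leq_eqVlt => /orP[/eqP->|l4].
  have k4 k : resU k 4 = 0 by rewrite /resU subrr.
  by rewrite (@eq_jpow _ _ _ (fun=> 0)) ?jpow0.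
rewrite jpowSr (eq_jpow _ (fun k => resU_jac k l4)) 2!jpowD !IHn ?(ltnW l4) // !addr0.
case: l l4 => [|l] l4; first by rewrite jpow0.
by rewrite IHn //; apply: ltnW; apply: ltnW.
Qed.

(* The coefficient of t^l in U_(3p+c), doubled for l = 2, 3 to be integral as a
   polynomial in p. *)
Definition resT_poly (c : nat) (p : int) (l : nat) : int :=
  match c, l with
  | 0%N, 0%N => 1
  | 1%N, 0%N => - 1
  | _, 0%N => 0
  | 0%N, 1%N => p
  | 1%N, 1%N => p + 1
  | _, 1%N => - 2 * (p + 1)
  | 0%N, 2%N => - 3 * p * (p + 1)
  | 1%N, 2%N => 3 * p * (p + 1)
  | _, 2%N => 2 * (p + 1)
  | 0%N, _ => p * (p + 1) * (2 - p)
  | 1%N, _ => - p * (p + 1) * (p + 3)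
  | _, _ => 2 * p * (p + 1) * (p + 2)
  end.

Definition resT (k l : nat) : int := resT_poly (k %% 3) (k %/ 3)%:Z l.

Lemma resTE c p l : (c < 3)%N -> resT (p * 3 + c) l = resT_poly c p%:Z l.
Proof. by move=> c3; rewrite /resT modnMDl divnMDl // modn_small // divn_small // addn0. Qed.

(** Multiplication by t shifts coefficients; the factor 2 enters at [l = 2], the first doubled
    column. *)
Lemma resT_jac l k : (l < 4)%N -> jac (resT^~ l) k =
  (if l is l'.+1 then (if l' is 1%N then 2 else 1) * resT k l' else 0).
Proof.
have jacS (f : nat -> int) j : jac f j.+1 = f j + f j.+1 + f j.+2 by [].
rewrite (divn_eq k 3); have : (k %% 3 < 3)%N by rewrite ltn_mod.
move: (k %/ 3)%N => p; case: (k %% 3)%N => [|[|[|c]]] // _.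
- case: p => [|p]; first by case: l => [|[|[|[|]]]].
  have E0 : (p.+1 * 3 + 0 = (p * 3 + 2).+1)%N by lia.
  have E1 : ((p * 3 + 2).+2 = p.+1 * 3 + 1)%N by lia.
  rewrite {1}E0 jacS E1 -E0 !resTE // intS.
  by case: l => [|[|[|[|l]]]] // _; rewrite ?resTE //=; ring.
- have E1 : (p * 3 + 1 = (p * 3 + 0).+1)%N by lia.
  have E2 : ((p * 3 + 0).+2 = p * 3 + 2)%N by lia.
  rewrite {1}E1 jacS E2 -E1 !resTE //.
  by case: l => [|[|[|[|l]]]] // _; rewrite ?resTE //=; ring.
have E1 : (p * 3 + 2 = (p * 3 + 1).+1)%N by lia.
have E2 : ((p * 3 + 1).+2 = p.+1 * 3 + 0)%N by lia.
rewrite {1}E1 jacS E2 -E1 !resTE // intS.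
by case: l => [|[|[|[|l]]]] // _; rewrite ?resTE //=; ring.
Qed.

Lemma resT_jpow n l k : (l < 4)%N -> (l < n)%N -> jpow n (resT^~ l) k = 0.
Proof.
elim: n l => // n IHn l l4 ln; rewrite jpowSr (eq_jpow _ (fun j => resT_jac j l4)).
case: l l4 ln => [|l] l4 ln; first by rewrite jpow0.
have l4' : (l < 4)%N by apply: ltnW.
case: l l4 l4' ln => [|[|l]] l4 l4' ln;
  under eq_jpow => j do rewrite ?mul1r ?mulrDl ?mul1r.
- by rewrite IHn.
- by rewrite jpowD !IHn.
by rewrite IHn.
Qed.

(** [x] stands for the residues modulo t^4; keeping it arbitrary separates the elimination from
    their polynomial form. *)
Definition residue_det8 s (x : nat -> nat -> int) : int :=
  detn 8 (fun i l => if (l < 4)%N then resU (s + i) l else x i (l - 4)%N).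

Definition row_entry (s : seq (nat -> int)) (i j : nat) : int := nth (fun=> 0) s i j.

(** Modulo U_4, U_4 and U_9 vanish, and U_k + U_k' vanishes if k + k' is 8 modulo 10. The four such
    relations among U_s, ..., U_(s+7) give the rows. *)
Definition residue_rows4 (s : nat) (x : nat -> nat -> int) : seq (nat -> int) :=
  match s with
  | 0%N => [:: x 4%N; fun l => x 5%N l + x 3%N l;
               fun l => x 6%N l + x 2%N l; fun l => x 7%N l + x 1%N l]
  | 1%N => [:: x 3%N; fun l => x 4%N l + x 2%N l;
               fun l => x 5%N l + x 1%N l; fun l => x 6%N l + x 0%N l]
  | 2%N => [:: x 2%N; fun l => x 3%N l + x 1%N l;
               fun l => x 4%N l + x 0%N l; x 7%N]
  | 3%N => [:: x 1%N; fun l => x 2%N l + x 0%N l; x 6%N;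
               fun l => x 7%N l + x 5%N l]
  | _ => [:: x 0%N; x 5%N; fun l => x 6%N l + x 4%N l; fun l => x 7%N l + x 3%N l]
  end.

Definition residue_det4 (s : nat) (x : nat -> nat -> int) : int :=
  (-1) ^+ ((s == 2) || (s == 3))%N * detn 4 (row_entry (residue_rows4 s x)).

(* The rows of resU are 0 and, up to sign, unit vectors, so that every pivot is a
   unit. *)
Local Ltac eliminate i0 e0 i1 e1 i2 e2 i3 e3 :=
  rewrite [RHS]/residue_det4 /=;
  rewrite (@detn_pivot _ 7 i0 e0) // (@detn_pivot _ 6 i1 e1) //
    (@detn_pivot _ 5 i2 e2) // (@detn_pivot _ 4 i3 e3) // !mulrA;
  congr (_ * _) => //; apply: eq_detn;
  case=> [|[|[|[|i]]]] [|[|[|[|j]]]] // _ _;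
  rewrite /row_entry /bump /resU /addn /subn /=; ring.

Lemma residue_det8E s x : residue_det8 s x = residue_det4 (s %% 5) x.
Proof.
have -> : residue_det8 s x = residue_det8 (s %% 10) x.
  by apply: eq_detn => i l _ _; case: ifP => // l4; rewrite /resU modnDml.
rewrite -(@modn_dvdm 10 s 5) //; have : (s %% 10 < 10)%N by rewrite ltn_mod.
rewrite /residue_det8; move: (s %% 10)%N => c.
(* Each pair is the position of a pivot among the remaining rows, followed by its inverse. *)
case: c => [|c] c10; 
  first by eliminate 0%N (1 : int) 0%N (1 : int) 0%N (1 : int) 0%N (1 : int).
case: c c10 => [|c] c10; 
  first by eliminate 7%N (- 1 : int) 0%N (1 : int) 0%N (1 : int) 0%N (1 : int).
case: c c10 => [|c] c10; 
  first by eliminate 6%N (- 1 : int) 5%N (- 1 : int) 0%N (1 : int) 0%N (1 : int).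
case: c c10 => [|c] c10; 
  first by eliminate 5%N (- 1 : int) 4%N (- 1 : int) 3%N (- 1 : int) 0%N (1 : int).
case: c c10 => [|c] c10; 
  first by eliminate 4%N (- 1 : int) 3%N (- 1 : int) 2%N (- 1 : int) 1%N (- 1 : int).
case: c c10 => [|c] c10; 
  first by eliminate 3%N (- 1 : int) 2%N (- 1 : int) 1%N (- 1 : int) 0%N (- 1 : int).
case: c c10 => [|c] c10; 
  first by eliminate 2%N (- 1 : int) 1%N (- 1 : int) 0%N (- 1 : int) 4%N (1 : int).
case: c c10 => [|c] c10; 
  first by eliminate 1%N (- 1 : int) 0%N (- 1 : int) 3%N (1 : int) 3%N (1 : int).
case: c c10 => [|c] c10; 
  first by eliminate 0%N (- 1 : int) 2%N (1 : int) 2%N (1 : int) 2%N (1 : int).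
case: c c10 => [|c] c10; 
  first by eliminate 1%N (1 : int) 1%N (1 : int) 1%N (1 : int) 1%N (1 : int).
by [].
Qed.

(** The 4 comes from the two doubled columns of [resT]. *)
Lemma residue_det8_0 : residue_det8 0 resT = 4.
Proof.
by rewrite residue_det8E /residue_det4 /residue_rows4 /= detn4E !detn3E
  /row_entry /bump; vm_compute.
Qed.

Lemma hankel_F5_det8 n : 4 * hankel n (F 5) = residue_det8 n (fun i => resT (n + i)).
Proof.
pose K k l := if (l < 4)%N then resU k l else resT k (l - 4).
have K8 : detn 8 K = 4 by rewrite -residue_det8_0.
rewrite mulrC -K8 hankel_motzkin_power (@detn_christoffel _ n 8).
- by rewrite -signr_odd oddM andbF expr0 mul1r.
- by move=> i; rewrite (_ : 8 + i = i + 4 + 4)%N ?jpow_lead //; lia.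
- by move=> i k ik; rewrite jpow_supp //; lia.
(* Row [i] represents t^(i+4) U_4, whose residues modulo U_4 and modulo t^4 are zero. *)
move=> i l lin l8; rewrite (@sum_jpow _ (i + 4) 4 (n + 8) (K^~ l)); last by lia.
rewrite /K; case: (ltnP l 4) => l4; first exact: resU_jpow (ltnW l4).
by apply: resT_jpow; lia.
Qed.

(** The elimination has period 5 in the order and [resT_poly] splits by classes modulo 3, hence 15;
    adding 15m to the order adds 5m to [p]. *)
Lemma hankel_F5_det4 m r :
  4 * hankel (15 * m + r) (F 5) =
  residue_det4 (r %% 5) (fun i => resT_poly ((r + i) %% 3) (5 * m%:Z + ((r + i) %/ 3)%:Z)).
Proof.
rewrite hankel_F5_det8.
have -> : (r %% 5 = (15 * m + r) %% 5)%N.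
  by rewrite -[15%N]/(5 * 3)%N -mulnA mulnC modnMDl.
rewrite -residue_det8E; apply: eq_detn => i l _ _; case: ifP => // _.
rewrite /resT -addnA -[15%N]/(3 * 5)%N -mulnA [(3 * _)%N]mulnC modnMDl divnMDl //.
Qed.


(** At order [15 * n + 9] the sign is opposite to that at [15 * n + 12] and to the opening formula:
    for [n = 0] the determinant is -1000. *)
Theorem theorem4 (n : nat) :
  (hankel (15 * n)%N (F 5) = 1 /\
   hankel (15 * n + 1)%N (F 5) = 1) /\
  hankel (15 * n + 2)%N (F 5) =
    5 * (2 * n%:Z + 1) * (50 * n%:Z ^+ 2 + 15 * n%:Z - 1) /\
  hankel (15 * n + 3)%N (F 5) =
    25 * (25 * n%:Z ^+ 2 + 25 * n%:Z - 2) * (2 * n%:Z + 1) ^+ 2 /\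
  hankel (15 * n + 4)%N (F 5) =
    - 5 * (50 * n%:Z ^+ 2 + 85 * n%:Z + 34) * (2 * n%:Z + 1) /\
  (hankel (15 * n + 5)%N (F 5) = 1 /\
   hankel (15 * n + 6)%N (F 5) = 1) /\
  hankel (15 * n + 7)%N (F 5) =
    5 * (n%:Z + 1) * (100 * n%:Z ^+ 2 + 120 * n%:Z + 33) /\
  hankel (15 * n + 8)%N (F 5) =
    25 * (n%:Z + 1) ^+ 2 * (100 * n%:Z ^+ 2 + 100 * n%:Z + 17) /\
  (hankel (15 * n + 9)%N (F 5) = - (1000 * (n%:Z + 1) ^+ 3) /\
   hankel (15 * n + 12)%N (F 5) = 1000 * (n%:Z + 1) ^+ 3) /\
  (hankel (15 * n + 10)%N (F 5) = 0 /\
   hankel (15 * n + 11)%N (F 5) = 0) /\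
  hankel (15 * n + 13)%N (F 5) =
    25 * (n%:Z + 1) ^+ 2 * (100 * n%:Z ^+ 2 + 300 * n%:Z + 217) /\
  hankel (15 * n + 14)%N (F 5) =
    - 5 * (n%:Z + 1) * (100 * n%:Z ^+ 2 + 280 * n%:Z + 193).
Proof.
rewrite -{1}[(15 * n)%N]addn0.
do !split.
all: apply: (mulfI (isT : 4 != 0 :> int)).
all: rewrite hankel_F5_det4 /residue_det4 /residue_rows4 /= detn4E !detn3E
  /row_entry /bump /divn /addn /=.
all: ring.
Qed.
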